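(* Let $\mathbf{Q}$, $\mathbf{A}$, $\mathbf{I}$ be a closed rectangle, a closed annulus and a closed interval in $\mathbb{C}$, with interiors $Q$, $A$ and $I$ ($I$ being $\mathbf{I}$ minus its endpoints). Then $\mathrm{Poly}_d^{mt}(\mathbf{Q})$, $\mathrm{Poly}_d^{mt}(\mathbf{A})$ and $\mathrm{Poly}_d^{mt}(\mathbf{I})$ are compactifications of $\mathrm{Poly}_d^{mt}(Q)$, $\mathrm{Poly}_d^{mt}(A)$ and $\mathrm{Poly}_d^{mt}(I)$, respectively.
   Context: $d\ge2$. $\mathrm{Poly}_d^{mt}$ is the space of monic degree-$d$ complex polynomials modulo precomposition with translations, topologized via coefficients of the centered representative; $\mathrm{Poly}_d^{mt}(X)$ is the subspace of classes whose critical values (values of $p$ at roots of $p'$) all lie in $X\subseteq\mathbb{C}$. A compactification of a space $Y$ is a compact space containing $Y$ as a dense subspace. *)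

(* Defs.v *)
From mathcomp Require Import all_boot all_order all_algebra.
From mathcomp Require Import all_classical all_reals all_analysis.
From mathcomp Require Import complex.
Import numFieldNormedType.Exports.
Import Order.TTheory GRing.Theory Num.Theory.

Set Implicit Arguments.
Unset Strict Implicit.
Unset Printing Implicit Defensive.

Local Open Scope ring_scope.
Local Open Scope classical_set_scope.

(* The complex numbers C = R[i] over a real field R : realType, seen as a
   numClosedFieldType, hence carrying its standard (modulus) metric topology. *)
Definition Cplx (R : realType) : numClosedFieldType := R[i].

(* Poly_d^{mt}: a class of monic degree-d polynomials modulo translation
   z |-> z + c is represented by its unique centered representative
   z^d + a_(d-2) z^(d-2) + ... + a_1 z + a_0, i.e. by its coefficient vector
   (a_0, ..., a_(d-2)) in C^(d-1); the topology is the product topology of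
   C^(d-1) (topology via coefficients of the centered representative). *)
Definition PolyMT (R : realType) (d : nat) := 'rV[Cplx R]_(d.-1).

Definition cpoly (R : realType) (d : nat) (a : PolyMT R d) : {poly Cplx R} :=
  'X^d + \sum_(i < d.-1) (a ord0 i)%:P * 'X^i.

Definition critical_value (R : realType) (p : {poly Cplx R}) (w : Cplx R) :=
  exists z : Cplx R, root p^`() z /\ p.[z] = w.

Definition PolyMT_in (R : realType) (d : nat) (X : set (Cplx R)) :
    set (PolyMT R d) :=
  [set a | forall w, critical_value (cpoly a) w -> X w].

Definition is_compactification (T : topologicalType) (K Y : set T) :=
  [/\ compact K, Y `<=` K & K `<=` closure Y].

(* closed rectangle with one vertex z0, sides of lengths a, b > 0 along the
   orthogonal directions u and u*i (|u| = 1) *)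
Definition closed_rectangle (R : realType) (z0 u : Cplx R) (a b : R) :
    set (Cplx R) :=
  [set z | exists s t : R, [/\ 0 <= s <= a, 0 <= t <= b &
      z = z0 + u * ((s%:C)%C + 'i%C * (t%:C)%C)]].

Definition closed_annulus (R : realType) (c : Cplx R) (r1 r2 : R) :
    set (Cplx R) :=
  [set z | (r1%:C)%C <= `|z - c| <= (r2%:C)%C].

Definition closed_segment (R : realType) (p q : Cplx R) : set (Cplx R) :=
  [set z | exists t : R, 0 <= t <= 1 /\ z = p + (t%:C)%C * (q - p)].
Definition open_segment (R : realType) (p q : Cplx R) : set (Cplx R) :=
  [set z | exists t : R, 0 < t < 1 /\ z = p + (t%:C)%C * (q - p)].

Arguments PolyMT_in {R} d X.

(* Main.v *)
Require Import Defs.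
From mathcomp Require Import all_boot all_order all_algebra.
From mathcomp Require Import all_classical all_reals all_analysis.
From mathcomp Require Import complex.
From mathcomp Require Import ring zify lra.
Import numFieldNormedType.Exports.
Import Order.TTheory GRing.Theory Num.Theory.
Set Implicit Arguments.
Unset Strict Implicit.
Unset Printing Implicit Defensive.
Local Open Scope ring_scope.

(** Compactness: a root of p' moves continuously with p, so the critical values
    persist and Poly(X) is closed when X is.  A centered monic polynomial all
    of whose critical values are 0 is divisible by its derivative, hence equals
    z^d; by compactness the critical values of the polynomials in a compact
    "polyannulus" of coefficient vectors have a uniform lower bound on their
    maximal modulus, and the rescalings l^d p(z/l), which multiply critical
    values by l^d, turn this into a bound on Poly(X) for bounded X.

    Density: for the rectangle and the interval the same rescaling, recentered
    at the midpoint m, contracts the critical values towards m.  The annulus is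
    not convex, so each critical value has to be moved in its own direction: if
    F is a polynomial taking prescribed values at the critical values of p, and
    h is the remainder of F o p modulo p', then p + t h is, to first order in t,
    (id + t F) o p precomposed with a change of variable, so its critical
    values are v + t F(v) + O(t^2), where v runs over those of p. *)

(** * Roots, derivatives and interpolation over a closed numeric field *)

Section NumClosed.
Variable K : numClosedFieldType.
Implicit Types (p q F h : {poly K}) (s : seq K).

Lemma size_deriv_char0 p : size p^`() = (size p).-1.
Proof.
have [s1|s1] := leqP (size p) 1.
  by rewrite (size1_polyC s1) derivC size_poly0 size_polyC; case: eqP.
have s2 : (size p).-2.+1 = (size p).-1 by case: (size p) s1 => [|[]].
apply: size_poly_eq; rewrite s2 mulrn_eq0 -{1}s2 /= -/(lead_coef p).
by rewrite lead_coef_eq0 -size_poly_gt0 ltnW.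
Qed.

Lemma closed_field_monic_roots p : p \is monic ->
  exists2 s, p = \prod_(c <- s) ('X - c%:P) & (size s).+1 = size p.
Proof.
move=> /monicP p_monic; have [s ps] := closed_field_poly_normal p.
rewrite p_monic scale1r in ps; exists s => //.
by rewrite {1}ps size_prod_XsubC.
Qed.

(** The modulus of [p.[z]] is the product of the distances from [z] to the roots, so these distances
    cannot all be at least [e]. *)
Lemma root_in_disk p z (e : K) : p \is monic -> 0 <= e ->
  `|p.[z]| < e ^+ (size p).-1 -> exists2 c, root p c & `|z - c| < e.
Proof.
move=> p_monic e0; have [s ps szs] := closed_field_monic_roots p_monic.
rewrite -szs /= => pz.
have : has (fun c => `|z - c| < e) s.
  apply: contraTT pz => /hasPn far.
  rewrite real_ltNge ?ger0_real ?exprn_ge0 // negbK ps.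
  elim: s far {ps szs} => [|c s IH] far.
    by rewrite big_nil hornerC normr1 expr0.
  rewrite big_cons hornerM hornerXsubC normrM exprS ler_pM ?exprn_ge0 //.
    by rewrite real_leNgt ?ger0_real ?far ?mem_head.
  by apply: IH => x xs; rewrite far // in_cons xs orbT.
by move=> /hasP[c cs zc]; exists c => //; rewrite ps root_prod_XsubC.
Qed.

(** The logarithmic derivative p'/p is the sum of the 1/(z - c), each of modulus at most 1/e;
    denominators are cleared so that induction on [s] applies. *)
Lemma deriv_far_from_roots s z (e : K) : 0 <= e ->
  {in s, forall c, e <= `|z - c|} ->
  let p := \prod_(c <- s) ('X - c%:P) in
  `|p^`().[z]| * e <= `|p.[z]| * (size s)%:R.
Proof.
move=> e0; elim: s => [|c s IH] far /=.
  by rewrite !big_nil derivC horner0 normr0 mul0r mulr_ge0.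
have {}IH := IH (fun x xs => far x (mem_behead (s := c :: s) xs)).
rewrite !big_cons derivM derivXsubC mul1r !hornerE.
apply: le_trans (ler_wpM2r e0 (ler_normD _ _)) _.
rewrite mulrDl -natr1 mulrDr mulr1 addrC !normrM lerD //.
  by rewrite -!mulrA ler_wpM2l.
by rewrite mulrC ler_wpM2r // far ?mem_head.
Qed.

Lemma lagrange_interpolation s (f : K -> K) :
  exists F, {in s, forall c, F.[c] = f c}.
Proof.
elim: s => [|c s [F FP]]; first by exists 0.
have [cs|cs] := boolP (c \in s).
  by exists F => x; rewrite inE => /predU1P[->|]; apply: FP.
pose N := \prod_(x <- s) ('X - x%:P).
have Nc : N.[c] != 0 by rewrite -/(root N c) root_prod_XsubC.
exists (F + ((f c - F.[c]) / N.[c]) *: N) => x; rewrite inE !hornerE.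
move=> /predU1P[->|xs]; first by rewrite divfK // addrC subrK.
have /eqP -> : root N x by rewrite root_prod_XsubC.
by rewrite mulr0 addr0 FP.
Qed.

(** Cauchy's bound: when |z| > 1, the equation expresses z^n through lower powers, each of modulus
    at most |z|^(n-1). *)
Lemma monic_root_bound p z : p \is monic -> root p z ->
  `|z| <= 1 + \sum_(i < (size p).-1) `|p`_i|.
Proof.
move=> p_monic /eqP pz; set n := (size p).-1.
have sz : size p = n.+1 by rewrite prednK // size_poly_gt0 monic_neq0.
have sum_ge0 : 0 <= \sum_(i < n) `|p`_i| by apply: sumr_ge0.
have [z1|z1] := real_leP (normr_real z) (@real1 K).
  by apply: le_trans z1 _; rewrite lerDl.
have z0 : 0 < `|z| by apply: lt_trans z1.
apply: le_trans (_ : _ <= \sum_(i < n) `|p`_i|) _; last by rewrite lerDr.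
rewrite -(ler_pM2r (exprn_gt0 n z0)) -exprS exprSr.
have zn : z ^+ n = - \sum_(i < n) p`_i * z ^+ i.
  move: pz; rewrite horner_coef sz big_ord_recr /=.
  have -> : p`_n = 1 by move/monicP: p_monic; rewrite /lead_coef.
  by rewrite mul1r addrC => /eqP; rewrite addr_eq0 => /eqP.
have {}zn : `|z| ^+ n <= \sum_(i < n) `|p`_i| * `|z| ^+ i.
  rewrite -normrX zn normrN; apply: le_trans (ler_norm_sum _ _ _) _.
  by apply: ler_sum => i _; rewrite normrM normrX.
apply: le_trans (ler_wpM2r (ltW z0) zn) _.
rewrite !mulr_suml; apply: ler_sum => i _.
by rewrite -mulrA ler_wpM2l // -exprSr ler_weXn2l // ltW.
Qed.

(** Write p' = t g with g = gcd(p, p'). A root c of t would be a root of p, of multiplicity m+1 say,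
    hence of multiplicity exactly m in p'. But (X - c)^m divides g, so (X - c)^(m+1) would divide
    p'. Thus t is constant. *)
Lemma deriv_dvdp p : p != 0 -> (forall c, root p^`() c -> root p c) ->
  p^`() %| p.
Proof.
move=> p0 crit0; set g := gcdp p p^`().
have g0 : g != 0 by rewrite gcdp_eq0 negb_and p0.
have gp : g %| p := dvdp_gcdl _ _.
have gp' : g %| p^`() := dvdp_gcdr _ _.
case/dvdpP: (gp') => t p't.
have [|t1] := boolP (size t == 1); last first.
  have [c tc] := closed_rootP _ t1.
  have p'c : root p^`() c by rewrite p't rootM tc.
  have [m [u uc pu]] := multiplicity_XsubC p c; rewrite p0 /= in uc.
  case: m pu => [|m] pu.
    by move: (crit0 _ p'c); rewrite pu mulr1 (negPf uc).
  have p'E : p^`() = ('X - c%:P) ^+ m * (u^`() * ('X - c%:P) + u *+ m.+1).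
    rewrite pu derivM deriv_exp derivXsubC mul1r exprS /= mulrDr.
    congr (_ + _); last by rewrite !mulrnAr mulrC.
    by rewrite [RHS]mulrCA [X in _ = _ * X]mulrC.
  have Xg : ('X - c%:P) ^+ m %| g.
    rewrite dvdp_gcd p'E dvdp_mulIl pu exprS andbT.
    by rewrite mulrA dvdp_mulIr.
  have : ('X - c%:P) ^+ m.+1 %| p^`().
    by rewrite p't exprS dvdp_mul // dvdp_XsubCl.
  rewrite p'E exprSr dvdp_mul2l ?expf_neq0 ?polyXsubC_eq0 //.
  rewrite dvdp_XsubCl rootE !hornerE subrr mulr0 add0r hornerMn mulrn_eq0 /=.
  by rewrite -rootE (negPf uc).
case/size_poly1P=> x x0 tE; apply: dvdp_trans gp.
by rewrite p't tE mul_polyC dvdpZl.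
Qed.

(** * First-order perturbation of critical points and critical values *)

Section Perturbation.
Variables (p F : {poly K}).
Hypotheses (p_monic : p \is monic) (p_nonconst : (1 < size p)%N).
Let k := (F \Po p) %/ p^`().
Let h := (F \Po p) %% p^`().

Let d := (size p).-1.

Lemma deriv_monic_eq0 : p^`() != 0.
Proof.
by rewrite -size_poly_eq0 size_deriv_char0 -lt0n -ltnS prednK // ltnW.
Qed.

(** The remainder has degree at most d-2, so adding a multiple of it keeps a polynomial monic and
    centered. *)
Lemma size_perturbation : (size h < d)%N.
Proof. by rewrite /d -size_deriv_char0 ltn_modp deriv_monic_eq0. Qed.

Lemma lead_coef_deriv_monic : lead_coef p^`() = d%:R.
Proof.
rewrite /lead_coef size_deriv_char0 coef_deriv.
have <- : d = d.-1.+1 by rewrite prednK // -ltnS prednK // ltnW.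
by move/monicP: p_monic; rewrite /lead_coef => ->.
Qed.

Let hE : h = F \Po p - k * p^`().
Proof. by rewrite [F \Po p](divp_eq _ p^`()) addrC addKr. Qed.

Let d_gt0 : (0 < d)%N.
Proof. by rewrite -ltnS prednK // ltnW. Qed.

Let d0 : (d%:R : K) != 0.
Proof. by rewrite pnatr_eq0 -lt0n. Qed.

(** Since h' has smaller degree than p', the leading coefficient of p' + t h' stays equal to d, and
    Cauchy's bound is uniform in t < 1. *)
Lemma perturbed_crit_bounded : exists2 B, 0 <= B &
  forall t z, 0 < t < 1 -> root (p + t *: h)^`() z -> `|z| <= B.
Proof.
exists (1 + \sum_(i < d.-1) (`|p^`()`_i| + `|h^`()`_i|)).
  by rewrite addr_ge0 // sumr_ge0 // => i _; rewrite addr_ge0.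
move=> t z /andP[t0 t1] qz; set q := (p + t *: h)^`() in qz.
have sz_th : (size (t *: h^`())%R < size p^`())%N.
  apply: leq_ltn_trans (size_scale_leq _ _) _.
  rewrite !size_deriv_char0 (leq_ltn_trans (leq_pred _)) //.
  exact: size_perturbation.
have szq : size q = size p^`() by rewrite /q derivD derivZ size_polyDl.
pose q1 := d%:R^-1 *: q.
have q1_monic : q1 \is monic.
  rewrite monicE lead_coefZ /q derivD derivZ lead_coefDl //.
  by rewrite lead_coef_deriv_monic mulVf.
have szq1 : (size q1).-1 = d.-1.
  by rewrite size_scale ?invr_eq0 // szq size_deriv_char0.
apply: le_trans (monic_root_bound q1_monic _) _; first by rewrite rootZ ?invr_eq0.
rewrite szq1 lerD2l; apply: ler_sum => i _.
rewrite coefZ normrM /q derivD derivZ coefD coefZ.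
rewrite normfV normr_nat ler_pdivrMl ?ltr0n //.
apply: le_trans (_ : _ <= 1 * (`|p^`()`_i| + `|h^`()`_i|)) _; last first.
  by rewrite ler_wpM2r ?addr_ge0 // ler1n.
rewrite mul1r; apply: le_trans (ler_normD _ _) _.
by rewrite lerD2l normrM gtr0_norm // ler_piMl // ltW.
Qed.

(** Under a general perturbation a critical point of multiplicity m moves by an order of t^(1/m).
    Here h' = G p' - k p'' with G = F' o p - k', and this special form gives a displacement linear
    in t even at multiple critical points. *)
Lemma perturbed_crit_near : exists2 C, 0 < C & exists2 t0, 0 < t0 <= 1 &
  forall t z, 0 < t < t0 -> root (p + t *: h)^`() z ->
  exists2 c, root p^`() c & `|z - c| <= C * t.
Proof.
have [B B0 critB] := perturbed_crit_bounded.
have [s p's] := closed_field_poly_normal p^`().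
rewrite lead_coef_deriv_monic in p's.
set P := \prod_(c <- s) _ in p's.
have [M1 G_le] := poly_disk_bound (F^`() \Po p - k^`()) B.
have [M2 k_le] := poly_disk_bound k B.
have M1_ge0 : 0 <= M1 by apply: le_trans (G_le 0 _); rewrite ?normr0.
have M2_ge0 : 0 <= M2 by apply: le_trans (k_le 0 _); rewrite ?normr0.
set n := (size s)%:R : K.
(* The bound [t0] below gives t M1 <= 1/2, hence |1 + t G| >= 1/2. A critical point farther than C t
   from all roots of p' would then force C <= 2 M2 n, which the added 1 excludes. *)
pose C := 2 * (M2 * n) + 1.
have C0 : 0 < C by rewrite ltr_wpDl // !mulr_ge0.
have D0 : 0 < 1 + 2 * M1 by rewrite ltr_wpDr // mulr_ge0.
exists C => //; exists (1 + 2 * M1)^-1.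
  by rewrite invr_gt0 D0 invf_le1 // lerDl mulr_ge0.
move=> t z /andP[t0 tM] qz.
have t1 : t < 1 by apply: lt_le_trans tM _; rewrite invf_le1 // lerDl mulr_ge0.
have zB : `|z| <= B by apply: critB qz; rewrite t0.
have [/hasP[c cs zc]|/hasPn far] := boolP (has (fun c => `|z - c| <= C * t) s).
  by exists c => //; rewrite p's rootZ // root_prod_XsubC.
have Ct0 : 0 < C * t by rewrite mulr_gt0.
have {}far c : c \in s -> C * t < `|z - c|.
  by move=> /far; rewrite -real_ltNge ?ger0_real // ltW.
have Pz : P.[z] != 0.
  rewrite -/(root P z) root_prod_XsubC; apply/negP => /far.
  by rewrite subrr normr0 => /(lt_trans Ct0); rewrite ltxx.
have PE : P.[z] * (1 + t * (F^`() \Po p - k^`()).[z]) = t * (k.[z] * P^`().[z]).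
  apply: (mulfI d0).
  move: qz; rewrite /root derivD derivZ hE derivB derivM deriv_comp.
  rewrite p's derivZ !hornerE !horner_comp /= => /eqP qz.
  apply/eqP; rewrite -subr_eq0 -qz; apply/eqP.
  by move: d%:R P.[z] P^`().[z] k.[z] => *; ring.
(* |p''/p'| <= n / dist(z, roots of p'), against p' (1 + t G) = t k p'' at z *)
have := deriv_far_from_roots (ltW Ct0) (fun c cs => ltW (far c cs)).
rewrite /= -/P -/n => PP'.
have : C * (1 - t * M1) <= M2 * n.
  have : `|P.[z]| * (C * (1 - t * M1)) <= `|P.[z]| * (M2 * n).
    pose G := F^`() \Po p - k^`().
    apply: le_trans (_ : _ <= `|P.[z]| * (C * `|1 + t * G.[z]|)) _.
      rewrite ler_wpM2l // ler_wpM2l ?(ltW C0) //.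
      apply: le_trans _ (lerB_normD _ _); rewrite normr1 lerD2l lerN2.
      by rewrite normrM gtr0_norm // ler_wpM2l ?G_le // ltW.
    rewrite mulrCA -normrM PE !normrM gtr0_norm //.
    rewrite [leRHS]mulrCA.
    apply: le_trans (ler_wpM2l M2_ge0 PP').
    have -> : C * (t * (`|k.[z]| * `|P^`().[z]|)) =
              `|k.[z]| * (`|P^`().[z]| * (C * t)) by ring.
    by rewrite ler_wpM2r ?k_le // mulr_ge0 // ltW.
  by rewrite ler_pM2l // normr_gt0.
have tM1 : t * (2 * M1) <= 1.
  have : t * (1 + 2 * M1) <= 1 by rewrite -ler_pdivlMr // mul1r ltW.
  by apply: le_trans; rewrite ler_wpM2l ?lerDr // ltW.
have C_le : C <= 2 * (C * (1 - t * M1)).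
  rewrite mulrCA -[leLHS]mulr1 ler_wpM2l ?(ltW C0) //.
  rewrite mulrBr mulr1 mulrCA lerBrDr -lerBrDl.
  by apply: le_trans tM1 _; rewrite lerBrDr.
move=> C_le'; have : C <= 2 * (M2 * n) by apply: le_trans C_le _; rewrite ler_wpM2l.
by rewrite /C -lerBrDl subrr ler10.
Qed.

(** At a critical point c of p, the expansion p = p(c) + e (X - c)^2 has no linear term, and h(c) =
    F(p(c)) because p'(c) = 0. With |z - c| <= C t, both the quadratic term of p and the linear term
    of t h are O(t^2). *)
Lemma perturbed_crit_value : exists2 M, 0 <= M & exists2 t0, 0 < t0 <= 1 &
  forall t z, 0 < t < t0 -> root (p + t *: h)^`() z ->
  exists2 c, root p^`() c &
    `|(p + t *: h).[z] - (p.[c] + t * F.[p.[c]])| <= M * t ^+ 2.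
Proof.
have [C C0 [t0 /andP[t0_gt0 t0_le1] nearP]] := perturbed_crit_near.
have C_ge0 := ltW C0.
have [s p's] := closed_field_poly_normal p^`().
rewrite lead_coef_deriv_monic in p's.
pose e c := (p - p.[c]%:P) %/ ('X - c%:P) ^+ 2.
pose f c := (h - F.[p.[c]]%:P) %/ ('X - c%:P).
have eE c : root p^`() c -> p = p.[c]%:P + e c * ('X - c%:P) ^+ 2.
  move=> p'c; suff /divpK -> : ('X - c%:P) ^+ 2 %| p - p.[c]%:P.
    by rewrite addrC subrK.
  have /factor_theorem[u pu] : root (p - p.[c]%:P) c.
    by rewrite rootE !hornerE subrr.
  have : root (p - p.[c]%:P)^`() c by rewrite derivB derivC subr0.
  rewrite {1}pu derivM derivXsubC mulr1 rootE !hornerE subrr mulr0 add0r => uc.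
  by rewrite pu expr2 dvdp_mul // dvdp_XsubCl.
have fE c : root p^`() c -> h = F.[p.[c]]%:P + f c * ('X - c%:P).
  move=> /eqP p'c; suff /divpK -> : ('X - c%:P) %| h - F.[p.[c]]%:P.
    by rewrite addrC subrK.
  by rewrite dvdp_XsubCl rootE hE !hornerE horner_comp p'c mulr0 subr0 subrr.
(* As t <= 1, the point z lies in the disk of radius |c| + C about 0, where the quotients are
   bounded independently of t. *)
pose E c := sval (poly_disk_bound (e c) (`|c| + C)).
pose Phi c := sval (poly_disk_bound (f c) (`|c| + C)).
have EP c z : `|z| <= `|c| + C -> `|(e c).[z]| <= E c.
  exact: (svalP (poly_disk_bound _ _)).
have PhiP c z : `|z| <= `|c| + C -> `|(f c).[z]| <= Phi c.
  exact: (svalP (poly_disk_bound _ _)).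
have E_ge0 c : 0 <= E c by apply: le_trans (EP c c _); rewrite ?lerDl.
have Phi_ge0 c : 0 <= Phi c by apply: le_trans (PhiP c c _); rewrite ?lerDl.
have M_ge0 c : 0 <= E c * C ^+ 2 + Phi c * C.
  by rewrite addr_ge0 ?mulr_ge0 ?exprn_ge0.
(* The sum over all critical points dominates the constant of whichever one turns out to be near
   z. *)
exists (\sum_(c <- s) (E c * C ^+ 2 + Phi c * C)); first by apply: sumr_ge0.
exists t0; rewrite ?t0_gt0 // => t z /andP[t_gt0 tt0] qz.
have [|c p'c zc] := nearP t z _ qz; first by rewrite t_gt0.
exists c => //.
have cs : c \in s by move: p'c; rewrite p's rootZ // root_prod_XsubC.
have t1 : t <= 1 by apply: le_trans (ltW tt0) _.
have zcC : `|z| <= `|c| + C.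
  rewrite -[z](subrK c) addrC; apply: le_trans (ler_normD _ _) _.
  by rewrite lerD2l (le_trans zc) // ler_piMr.
have M_le : E c * C ^+ 2 + Phi c * C <= \sum_(c <- s) (E c * C ^+ 2 + Phi c * C).
  by rewrite (big_rem c) //= lerDl sumr_ge0.
apply: le_trans (ler_wpM2r (exprn_ge0 _ (ltW t_gt0)) M_le).
have pz : p.[z] = p.[c] + (e c).[z] * (z - c) ^+ 2.
  by rewrite {1}(eE c p'c) !(hornerE, horner_exp).
have hz : h.[z] = F.[p.[c]] + (f c).[z] * (z - c) by rewrite {1}(fE c p'c) !hornerE.
rewrite hornerD hornerZ pz hz.
have -> : forall a b x y w : K, a + x * w ^+ 2 + t * (b + y * w) - (a + t * b) =
   x * w ^+ 2 + t * (y * w) by move=> *; ring.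
apply: le_trans (ler_normD _ _) _; rewrite normrM normrX !normrM (gtr0_norm t_gt0).
rewrite mulrDl lerD //.
  rewrite -mulrA -exprMn ler_pM ?EP ?exprn_ge0 //.
  by rewrite lerXn2r ?nnegrE ?mulr_ge0 // ltW.
have -> : Phi c * C * t ^+ 2 = t * (Phi c * (C * t)) by ring.
by rewrite ler_wpM2l ?(ltW t_gt0) // ler_pM ?PhiP.
Qed.

End Perturbation.
End NumClosed.

Local Open Scope classical_set_scope.

(** * Continuity of evaluation in the coefficients and the point *)

Section Continuity.
Variables (K : numFieldType) (T : Type) (F : set_system T).
Hypothesis FF : Filter F.

Lemma cvg_exprn (f : T -> K) (x : K) n :
  f @ F --> x -> f t ^+ n @[t --> F] --> x ^+ n.
Proof.
move=> fx; elim: n => [|n IH].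
  by under eq_fun do rewrite expr0; apply: cvg_cst.
under eq_fun do rewrite exprS; rewrite exprS.
exact: cvgM.
Qed.

Lemma cvg_rV n (f : T -> 'rV[K]_n) (a : 'rV[K]_n) :
  (forall i, f t ord0 i @[t --> F] --> a ord0 i) -> f @ F --> a.
Proof.
move=> fa; apply/cvg_ballP => e e0.
have : \forall t \near F, forall i, ball (a ord0 i) e (f t ord0 i).
  by apply: filter_forall => i; exact: (cvg_ball (fa i)).
by apply: filterS => t ft; split => // i j; rewrite ord1.
Qed.

Lemma cvg_horner_rVpoly n (f : T -> 'rV[K]_n) (a : 'rV[K]_n) (g : T -> K) (z : K) :
  f @ F --> a -> g @ F --> z ->
  (rVpoly (f t)).[g t] @[t --> F] --> (rVpoly a).[z].
Proof.
move=> fa gz.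
have E (b : 'rV[K]_n) x : (rVpoly b).[x] = \sum_(i < n) b ord0 i * x ^+ i.
  rewrite horner_poly; apply: eq_bigr => i _; rewrite insubT // => *.
  by congr (b _ _ * _); apply: val_inj.
under eq_fun do rewrite E; rewrite E.
apply: cvg_big => [|i _]; first exact: add_continuous.
apply: cvgM; last exact: cvg_exprn.
exact: (cvg_comp f _ fa (@coord_continuous K 1 n ord0 i a)).
Qed.

Lemma cvg_horner_deriv_rVpoly n (f : T -> 'rV[K]_n) (a : 'rV[K]_n) (z : K) :
  f @ F --> a ->
  (rVpoly (f t))^`().[z] @[t --> F] --> (rVpoly a)^`().[z].
Proof.
move=> fa.
have E (b : 'rV[K]_n) : (rVpoly b)^`().[z] = \sum_(i < n) b ord0 i * ('X^i)^`().[z].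
  rewrite /rVpoly poly_def (big_morph _ (@derivD K) (raddf0 _)) horner_sum.
  apply: eq_bigr => i _.
  rewrite derivZ hornerZ insubT // => *; congr (b _ _ * _); exact: val_inj.
under eq_fun do rewrite E; rewrite E.
apply: cvg_big => [|i _]; first exact: add_continuous.
apply: cvgMl.
exact: (cvg_comp f _ fa (@coord_continuous K 1 n ord0 i a)).
Qed.
End Continuity.

Lemma coef_comp_scale (A : comNzRingType) (p : {poly A}) (c : A) k :
  (p \Po (c *: 'X))`_k = p`_k * c ^+ k.
Proof.
elim/poly_ind: p k => [|p e IH] k; first by rewrite comp_poly0 !coef0 mul0r.
rewrite comp_polyD comp_polyM comp_polyX comp_polyC -scalerAr !coefD !coefC.
rewrite coefZ !coefMX; case: k => [|k] /=; first by rewrite mulr0 !add0r mulr1.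
by rewrite !addr0 IH exprS mulrCA.
Qed.

(** * Centered monic polynomials: persistence of critical values, rescaling *)

Section CenteredPolynomials.
Variable R : realType.
Notation C := (Cplx R).

Section Degree.
Variable d : nat.
Implicit Types (a b : PolyMT R d).

Lemma cpolyE a : cpoly a = 'X^d + rVpoly a.
Proof.
rewrite /cpoly /rVpoly poly_def; congr (_ + _); apply: eq_bigr => i _.
by rewrite insubT // mul_polyC => i_lt; congr (a _ _ *: _); apply: val_inj.
Qed.

Lemma cpolyD a (h : {poly C}) : (size h <= d.-1)%N ->
  cpoly a + h = cpoly (a + poly_rV h).
Proof. by move=> sh; rewrite !cpolyE linearD /= poly_rV_K // addrA. Qed.

Hypothesis d2 : (2 <= d)%N.
Let d_gt0 : (0 < d)%N. Proof. exact: leq_trans d2. Qed.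

Lemma size_rVpoly_lt a : (size (rVpoly a) < d)%N.
Proof. by apply: leq_ltn_trans (size_poly _ _) _; rewrite prednK. Qed.

Lemma size_cpoly a : size (cpoly a) = d.+1.
Proof.
by rewrite cpolyE size_polyDl size_polyXn // ltnS ltnW // size_rVpoly_lt.
Qed.

Lemma cpoly_monic a : cpoly a \is monic.
Proof.
rewrite monicE cpolyE lead_coefDl ?lead_coefXn //.
by rewrite size_polyXn ltnS ltnW // size_rVpoly_lt.
Qed.

Lemma coef_cpoly_ord a (i : 'I_d.-1) : (cpoly a)`_i = a ord0 i.
Proof.
rewrite cpolyE coefD coefXn coef_rVpoly_ord ltn_eqF ?add0r //.
by rewrite (leq_trans (ltn_ord i)) // leq_pred.
Qed.

Lemma coef_cpoly_pred a : (cpoly a)`_d.-1 = 0.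
Proof.
rewrite cpolyE coefD coefXn ltn_eqF ?ltn_predL // add0r.
by rewrite nth_default // size_poly.
Qed.

Let size_gt1 a : (1 < size (cpoly a))%N.
Proof. by rewrite size_cpoly ltnS. Qed.

Section Convergence.
Variables (T : Type) (F : set_system T).
Hypothesis FF : Filter F.

Lemma cvg_horner_cpoly (f : T -> PolyMT R d) a (g : T -> C) z :
  f @ F --> a -> g @ F --> z ->
  (cpoly (f t)).[g t] @[t --> F] --> (cpoly a).[z].
Proof.
move=> fa gz.
have E b x : (cpoly b).[x] = x ^+ d + (rVpoly b).[x].
  by rewrite cpolyE hornerD hornerXn.
under eq_fun do rewrite E; rewrite E.
by apply: cvgD; [exact: cvg_exprn|exact: cvg_horner_rVpoly].
Qed.

(** The factor 1/d makes the derivative monic, as [root_in_disk] requires. *)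
Lemma cvg_horner_deriv_cpoly (f : T -> PolyMT R d) a z :
  f @ F --> a ->
  (d%:R^-1 * (cpoly (f t))^`().[z]) @[t --> F] -->
    (d%:R^-1 * (cpoly a)^`().[z]).
Proof.
move=> fa; apply: cvgMr.
have E b : (cpoly b)^`().[z] = ('X^d)^`().[z] + (rVpoly b)^`().[z].
  by rewrite cpolyE derivD hornerD.
under eq_fun do rewrite E; rewrite E.
by apply: cvgD; [exact: cvg_cst|exact: cvg_horner_deriv_rVpoly].
Qed.
End Convergence.

(** For b near a, the monic polynomial b'/d of degree d-1 is smaller than e^(d-1) at z, so it has a
    root within e of z; joint continuity of evaluation places its value in [O]. *)
Lemma crit_value_near a w (O : set C) :
  critical_value (cpoly a) w -> nbhs w O ->
  \forall b \near a, exists2 w', critical_value (cpoly b) w' & O w'.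
Proof.
move=> [z [p'z pz]] Ow.
have : nbhs (a, z) [set bx : PolyMT R d * C | O (cpoly bx.1).[bx.2]].
  have : (cpoly bx.1).[bx.2] @[bx --> (a, z)] --> w.
    by rewrite -pz; apply: cvg_horner_cpoly; [exact: cvg_fst|exact: cvg_snd].
  exact.
case=> -[A B] /= [Aa Bz] AB.
have /nbhs_normP[e /= e0 eB] := Bz.
have d0 : (d%:R : C) != 0 by rewrite pnatr_eq0 -lt0n.
have := cvg_horner_deriv_cpoly (z := z) (nbhs_filter a) (@cvg_id _ (nbhs a)).
rewrite (eqP p'z) mulr0 => /cvgrPdist_lt /(_ (e ^+ d.-1)).
rewrite exprn_gt0 // => /(_ isT).
apply: filterS2 Aa => b Ab; rewrite sub0r normrN => bz.
have q_monic : d%:R^-1 *: (cpoly b)^`() \is monic.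
  rewrite monicE lead_coefZ lead_coef_deriv_monic ?cpoly_monic //.
  by rewrite size_cpoly mulVf.
have [||c qc zc] := root_in_disk (z := z) (e := e) q_monic; first exact: ltW.
  by rewrite hornerZ size_scale ?invr_eq0 // size_deriv_char0 size_cpoly.
exists (cpoly b).[c]; first by exists c; rewrite rootZ ?invr_eq0 in qc.
by apply: (AB (b, c)); split => //=; apply: eB.
Qed.

Lemma PolyMT_in_closed (X : set C) : closed X -> closed (PolyMT_in d X).
Proof.
move=> Xc a clPa w aw; apply: contrapT => Xw.
have : nbhs w (~` X) by apply: open_nbhs_nbhs; split => //; exact: closed_openC.
move=> /(crit_value_near aw)/clPa[b [Pb [w' bw' Xw']]].
exact/Xw'/Pb.
Qed.

(** All critical points are roots, so p = q p' with q linear. Comparing coefficients of degree d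
    gives q_1 = 1/d, then degree d-1 gives q_0 = 0 by centering; what remains is d p_i = i p_i, so
    p_i = 0 for i < d. *)
Lemma crit_values_eq0 a : (forall w, critical_value (cpoly a) w -> w = 0) -> a = 0.
Proof.
move=> crit0; set p := cpoly a.
have p_neq0 : p != 0 by apply: monic_neq0; exact: cpoly_monic.
have /dvdpP[q pq] : p^`() %| p.
  apply: deriv_dvdp => // c p'c; rewrite rootE; apply/eqP; apply: crit0.
  by exists c.
have p'0 : (p^`())%R != 0 by rewrite deriv_monic_eq0 ?size_gt1.
have q0 : q != 0 by apply: contra_neq p_neq0 => q0; rewrite pq q0 mul0r.
have sq : size q = 2.
  have := size_mul q0 p'0; rewrite -pq size_deriv_char0 size_cpoly /=.
  by case: (size q) => [|[|[|m]]] //=; lia.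
have qE : q = (q`_1)%:P * 'X + (q`_0)%:P.
  apply/polyP => -[|[|i]]; rewrite coefD coefMX !coefC /= ?add0r ?addr0 //.
  by rewrite nth_default // sq.
have p_d : p`_d = 1 by move/monicP: (cpoly_monic a); rewrite /lead_coef size_cpoly.
have coefp i : p`_i.+1 = q`_1 * (p`_i.+1 *+ i.+1) + q`_0 * (p`_i.+2 *+ i.+2).
  by rewrite {1}pq {1}qE mulrDl -mulrA coefD !coefCM coefXM /= !coef_deriv.
have coefp0 : p`_0 = q`_0 * p`_1.
  rewrite {1}pq {1}qE mulrDl -mulrA coefD !coefCM coefXM /=.
  by rewrite mulr0 add0r coef_deriv.
have p_gt i : (d < i)%N -> p`_i = 0 by move=> di; rewrite nth_default // size_cpoly.
have q1 : q`_1 * d%:R = 1.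
  have := coefp d.-1; rewrite prednK // p_d p_gt // mul0rn mulr0 addr0.
  exact: esym.
have dN0 : (d%:R : C) != 0 by rewrite pnatr_eq0 -lt0n.
have q00 : q`_0 = 0.
  have := coefp d.-2; have -> : d.-2.+1 = d.-1 by case: (d) d2 => [|[]].
  rewrite prednK // coef_cpoly_pred p_d mul0rn mulr0 add0r => /esym/eqP.
  by rewrite mulf_eq0 (negPf dN0) orbF => /eqP.
apply/rowP => -[[|i] i_lt]; rewrite mxE -coef_cpoly_ord -/p /=.
  by rewrite coefp0 q00 mul0r.
apply/eqP; have /eqP := coefp i; rewrite q00 mul0r addr0.
rewrite -[p`__ *+ _]mulr_natr mulrA [_ * p`__]mulrC -mulrA -subr_eq0.
rewrite -{1}[p`__]mulr1 -mulrBr mulf_eq0 => /orP[//|].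
rewrite -[X in X - _]q1 -mulrBr mulf_eq0 subr_eq0 eqr_nat => /orP[/eqP q10|/eqP di].
  by move/eqP: q1; rewrite q10 mul0r eq_sym oner_eq0.
by move: (leq_trans i_lt (leq_pred _)); rewrite [X in (_ < X)%N]di ltnn.
Qed.

(** Coefficients of l^d p(z/l) + m (1 - l^d), whose critical values are those of p moved by the
    homothety of center m and ratio l^d. The formula is polynomial in l, hence visibly
    continuous. *)
Definition rescale (m l : C) a : PolyMT R d :=
  \row_(i < d.-1) (l ^+ (d - i) * a ord0 i + m * (1 - l ^+ d) *+ (i == 0 :> nat)).

Lemma cpoly_rescale m l a : l != 0 ->
  cpoly (rescale m l a) =
    l ^+ d *: (cpoly a \Po (l^-1 *: 'X)) + (m * (1 - l ^+ d))%:P.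
Proof.
move=> l0; have lN0 n : l ^+ n != 0 by rewrite expf_neq0.
apply/polyP => k; rewrite [RHS]coefD coefC coefZ coef_comp_scale !cpolyE.
rewrite !(coefD 'X^d) coefXn !coef_rVpoly; case: insubP => [i _ ik|]; last first.
  rewrite -leqNgt => kd; rewrite !addr0.
  have -> : (k == 0) = false by case: k kd => //; case: (d) d2 => [|[]].
  rewrite addr0; case: eqP => [->|_]; rewrite ?mul0r ?mulr0 //.
  by rewrite mul1r -exprMn mulfV // expr1n.
have kd : (k < d)%N by rewrite -ik (leq_trans (ltn_ord i)) // leq_pred.
have ld : l ^+ d = l ^+ (d - k) * l ^+ k by rewrite -exprD subnK // ltnW.
rewrite ltn_eqF // !add0r mxE ik; congr (_ + _).
  by rewrite ld exprVn mulrCA mulfK // mulrC.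
by case: k {ik kd ld} => [|k]; rewrite /= ?mulr1n ?mulr0n.
Qed.

Lemma critical_value_rescale m l a w : l != 0 ->
  critical_value (cpoly (rescale m l a)) w ->
  exists2 v, critical_value (cpoly a) v & w = m + l ^+ d * (v - m).
Proof.
move=> l0 [z []]; rewrite cpoly_rescale // => p'z <-.
exists (cpoly a).[l^-1 * z]; last first.
  rewrite hornerD hornerC hornerZ horner_comp hornerZ hornerX.
  by move: (_ ^+ d) (horner _ _) => *; ring.
exists (l^-1 * z); split=> //; move: p'z.
rewrite rootE derivD derivC addr0 derivZ deriv_comp derivZ derivX alg_polyC.
rewrite hornerZ hornerM horner_comp hornerZ hornerX hornerC.
by rewrite !mulf_eq0 expf_eq0 invr_eq0 (negPf l0) andbF /= orbF.
Qed.

(** Each a in S is nonzero, so it has a critical value w != 0, and nearby polynomials keep one of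
    modulus above |w|/2. The near-covering form of compactness merges these local bounds into
    one. *)
Lemma compact_crit_value_gt (S : set (PolyMT R d)) : compact S ->
  ~ S 0 ->
  \forall r \near (0 : C)^'+,
     S `<=` [set a | exists2 w, critical_value (cpoly a) w & r < `|w|].
Proof.
move=> /compact_near_coveringP cS S0; apply: cS => a Sa.
have [w aw w0] : exists2 w, critical_value (cpoly a) w & w != 0.
  apply: contrapT => no_w; apply: S0; rewrite -(crit_values_eq0 (a := a)) //.
  by move=> w aw; apply/eqP; apply: contrapT => /negP w0; apply: no_w; exists w.
have w2 : 0 < `|w| / 2 by rewrite divr_gt0 ?normr_gt0.
have Ow : nbhs w [set w' | `|w| / 2 < `|w'|].
  apply/nbhs_normP; exists (`|w| / 2) => // w' /= ww'.
  rewrite -(ltrD2l (`|w| / 2)) -splitr.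
  apply: le_lt_trans (_ : _ <= `|w - w'| + `|w'|) _; last by rewrite ltrD2r.
  by rewrite -[in leLHS](subrK w' w) ler_normD.
exists ([set b | exists2 w', critical_value (cpoly b) w' & `|w| / 2 < `|w'|],
  [set r | r < `|w| / 2]) => /=.
  by split; [exact: crit_value_near aw Ow|exact: nbhs_right_lt].
move=> [b r] /= [[w' bw' ww'] rw]; exists w' => //; exact: lt_trans rw ww'.
Qed.
End Degree.
End CenteredPolynomials.

(** * Closed and compact subsets of the complex plane *)

Section NormClosed.
Variable K : numFieldType.

Lemma closed_norm_le (c r : K) : r \is Num.real ->
  closed [set z : K | `|z - c| <= r].
Proof.
move=> r_real z clz; rewrite /= real_leNgt ?normr_real //; apply/negP => rz.
have /clz[y [/= yr zy]] : nbhs z [set y | `|z - y| < `|z - c| - r].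
  by apply/nbhs_normP; exists (`|z - c| - r) => //=; rewrite subr_gt0.
have : `|z - c| < `|z - c|.
  apply: le_lt_trans (ler_distD y z c) _.
  by rewrite -[ltRHS](subrK r); exact: ltr_leD zy yr.
by rewrite ltxx.
Qed.

Lemma closed_norm_ge (c r : K) : r \is Num.real ->
  closed [set z : K | r <= `|z - c|].
Proof.
move=> r_real z clz; rewrite /= real_leNgt ?normr_real //; apply/negP => rz.
have /clz[y [/= yr zy]] : nbhs z [set y | `|z - y| < r - `|z - c|].
  by apply/nbhs_normP; exists (r - `|z - c|) => //=; rewrite subr_gt0.
have : r < r.
  apply: le_lt_trans (le_trans yr (ler_distD z y c)) _.
  by rewrite -ltrBrDr distrC.
by rewrite ltxx.
Qed.
End NormClosed.

Section ComplexCompact.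
Variable R : realType.
Notation C := (Cplx R).

Lemma real_complex_continuous : continuous (fun x : R => (x%:C)%C : C).
Proof.
move=> x; apply/cvgrPdist_lt => e e0.
have eE : e = ((complex.Re e)%:C)%C by rewrite RRe_real // gtr0_real.
have e0' : 0 < complex.Re e by rewrite -ltcR -eE.
have : \forall y \near x, `|x - y| < complex.Re e.
  by apply/nbhs_normP; exists (complex.Re e).
apply: filterS => y xy; rewrite eE -rmorphB normc_def /= expr0n addr0 sqrtr_sqr.
by rewrite ltcR.
Qed.

Lemma cvg_real_complex (T : Type) (F : set_system T) (FF : Filter F)
    (f : T -> R) (x : R) :
  f @ F --> x -> ((f t)%:C)%C @[t --> F] --> ((x%:C)%C : C).
Proof. by move=> fx; apply: cvg_comp fx _; exact: real_complex_continuous. Qed.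

Lemma closed_rectangle_compact (z0 u : C) (a b : R) :
  compact (closed_rectangle z0 u a b).
Proof.
have -> : closed_rectangle z0 u a b =
  (fun st : R * R => z0 + u * ((st.1%:C)%C + 'i%C * (st.2%:C)%C)) @`
    (`[0, a] `*` `[0, b]).
  apply/seteqP; split=> z /=.
    by move=> [s [t [sa tb ->]]]; exists (s, t); rewrite //= !in_itv.
  by move=> [[s t] [/=]]; rewrite !in_itv /= => sa tb <-; exists s, t.
apply: continuous_compact; last first.
  by apply: compact_setX; exact: segment_compact.
apply: continuous_subspaceT => st.
apply: cvgD; first exact: cvg_cst.
apply: cvgMr; apply: cvgD; last apply: cvgMr.
  by apply: cvg_real_complex; exact: cvg_fst.
by apply: cvg_real_complex; exact: cvg_snd.
Qed.

Lemma closed_segment_compact (p q : C) : compact (closed_segment p q).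
Proof.
have -> : closed_segment p q = (fun t : R => p + (t%:C)%C * (q - p)) @` `[0, 1].
  apply/seteqP; split=> z /=.
    by move=> [t [t01 ->]]; exists t => //; rewrite /= in_itv.
  by move=> [t /=]; rewrite in_itv /= => t01 <-; exists t.
apply: continuous_compact; last exact: segment_compact.
apply: continuous_subspaceT => t.
apply: cvgD; first exact: cvg_cst.
apply: cvgMl; exact: real_complex_continuous.
Qed.

Lemma normc_ge_Im (z : C) : (`|complex.Im z|%:C)%C <= `|z|.
Proof.
by rewrite normc_def -sqrtr_sqr lecR ler_wsqrtr // lerDr sqr_ge0.
Qed.

(** The disk is closed in the circumscribed square. The radius is an element of [C]; if it is not a
    nonnegative real, the disk is empty. *)
Lemma disk_compact (c : C) (M : C) : compact [set z : C | `|z - c| <= M].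
Proof.
have [M_ge0|M_lt0] := boolP (0 <= M); last first.
  have -> : [set z : C | `|z - c| <= M] = set0; last exact: compact0.
  by apply/seteqP; split=> // z /(le_trans (normr_ge0 _)); apply/negP.
have /complex_realP[m ME] := ger0_real M_ge0.
apply: (subclosed_compact (B := closed_rectangle
    (c - (m%:C)%C - 'i%C * (m%:C)%C) 1 (2 * m) (2 * m))).
- by apply: closed_norm_le; exact: ger0_real.
- exact: closed_rectangle_compact.
move=> z /= zM; set y := z - c in zM.
have := le_trans (normc_ge_Re y) zM; have := le_trans (normc_ge_Im y) zM.
rewrite ME !lecR !ler_norml => /andP[i1 i2] /andP[r1 r2].
exists (complex.Re y + m), (complex.Im y + m); split.
- by apply/andP; split; lra.
- by apply/andP; split; lra.
have zE : z = c + y by rewrite /y addrC subrK.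
rewrite zE [y in LHS]complexE !rmorphD /= mul1r.
by ring.
Qed.

Lemma closed_annulus_compact (c : C) (r1 r2 : R) : compact (closed_annulus c r1 r2).
Proof.
have real_c (r : R) : ((r%:C)%C : C) \is Num.real by apply/complex_realP; exists r.
apply: (subclosed_compact (B := [set z : C | `|z - c| <= (r2%:C)%C])).
  have -> : closed_annulus c r1 r2 =
    [set z | (r1%:C)%C <= `|z - c|] `&` [set z | `|z - c| <= (r2%:C)%C].
    by apply/seteqP; split=> z /=; [move/andP|move=> H; apply/andP].
  by apply: closedI; [apply: closed_norm_ge|apply: closed_norm_le].
  exact: disk_compact.
by move=> z /= /andP[].
Qed.

Lemma compact_norm_bounded (X : set C) : compact X ->
  exists2 M : C, 0 <= M & forall z, X z -> `|z| <= M.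
Proof.
move=> /compact_near_coveringP cX.
have : \forall M \near +oo, X `<=` [set z : C | `|z| <= (M%:C)%C].
  apply: cX => z _.
  exists ([set y | `|z - y| < 1], [set M | complex.Re `|z| + 1 < M]).
    split; last by apply: nbhs_pinfty_gt; exact: num_real.
    by apply/nbhs_normP; exists 1; first exact: ltr01.
  move=> [y M] /= [zy zM].
  apply: le_trans (_ : _ <= `|z| + 1) _.
    have := ler_distD z y 0; rewrite !subr0 => /le_trans; apply.
    by rewrite addrC lerD2l distrC ltW.
  have -> : `|z| + 1 = ((complex.Re `|z| + 1)%:C)%C :> C.
    by rewrite rmorphD rmorph1; congr (_ + _); rewrite RRe_real // normr_real.
  by rewrite lecR ltW.
move=> /filter_ex[M XM]; exists `|(M%:C)%C| => // z /XM /= zM.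
by apply: le_trans zM _; rewrite real_ler_norm //; apply/complex_realP; exists M.
Qed.
End ComplexCompact.

(** * Bounds on coefficients from bounds on critical values *)

Section Compactness.
Variables (R : realType) (d : nat).
Hypothesis d2 : (2 <= d)%N.
Notation C := (Cplx R).
Implicit Types a b : PolyMT R d.

Let d_gt0 : (0 < d)%N. Proof. exact: leq_trans d2. Qed.

Lemma exp2_ge_norm (z : C) : exists k, `|z| <= 2 ^+ k.
Proof.
have /complex_realP[x zx] := normr_real z.
have x_ge0 : 0 <= x by rewrite -ler0c -zx.
exists (Num.bound x).
rewrite zx -[2](rmorph_nat (real_complex R)) -rmorphXn lecR.
apply: le_trans (ltW (archi_boundP x_ge0)) _.
by rewrite -natrX ler_nat ltnW // ltn_expl.
Qed.

Lemma crit_value_gt_polyannulus : exists2 r : C, 0 < r &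
  forall (i : 'I_d.-1) a, (forall j, `|a ord0 j| <= 1) -> 2 ^- d <= `|a ord0 i| ->
  exists2 w, critical_value (cpoly a) w & r < `|w|.
Proof.
(* The polyannulus [S i] is the unit polydisk with its i-th coordinate kept at modulus at least
   2^-d. These finitely many compact sets avoid 0, so one r serves them all. *)
pose A (i j : 'I_d.-1) : set C :=
  [set z | `|z - 0| <= 1] `&` [set z | (j == i) -> 2 ^- d <= `|z - 0|].
pose S i : set (PolyMT R d) := [set a | forall j, A i j (a ord0 j)].
have cS i : compact (S i).
  apply: rV_compact => j; rewrite /A; have [_|_] := eqVneq j i; last first.
    have -> : [set z : C | (false -> 2 ^- d <= `|z - 0|)] = setT.
      by apply/seteqP; split.
    by rewrite setIT; exact: disk_compact.
  apply: (subclosed_compact (B := [set z : C | `|z - 0| <= 1])).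
  - apply: closedI; first by apply: closed_norm_le; exact: real1.
    have -> : [set z : C | (true -> 2 ^- d <= `|z - 0|)] =
        [set z | 2 ^- d <= `|z - 0|].
      by apply/seteqP; split=> z /=; [apply|].
    by apply: closed_norm_ge; rewrite ger0_real // invr_ge0 exprn_ge0.
  - exact: disk_compact.
  - by move=> z [].
have S0 i : ~ S i 0.
  move=> /(_ i)[_] /= /(_ (eqxx i)); rewrite mxE subr0 normr0.
  apply/negP; rewrite -real_ltNge ?ger0_real ?invr_gt0 ?exprn_gt0 //.
pose Q i (r : C) :=
  S i `<=` [set a | exists2 w, critical_value (cpoly a) w & r < `|w|].
have : \forall r \near (0 : C)^'+, 0 < r /\ forall i, Q i r.
  apply: filterI; first exact: nbhs_right_gt.
  apply: (@filter_forall C 'I_d.-1 Q (at_right 0) (at_right_proper_filter (0 : C))).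
  by move=> i; exact: (compact_crit_value_gt d2 (cS i) (@S0 i)).
move=> /filter_ex[r [r0 rS]]; exists r => // i a a1 ai.
by apply: (rS i) => j; split; rewrite /= subr0 // => /eqP ->.
Qed.

(** A rescaling by l that brings a into a polyannulus has a critical value of modulus above r and at
    most l^d M; hence l^-d <= M/r, which bounds the coefficients of a. *)
Lemma PolyMT_in_bounded (M : C) : 0 <= M -> exists B : C,
  forall a, (forall w, critical_value (cpoly a) w -> `|w| <= M) ->
  forall i, `|a ord0 i| <= B.
Proof.
move=> M0; have [r r0 r_lt] := crit_value_gt_polyannulus.
have Mr : 0 <= M / r by rewrite divr_ge0 // ltW.
exists (1 + M / r) => a aM j.
(* With k least such that P k, the rescaling of a by 2^-k lies in the unit
   polydisk but has a coefficient of modulus at least 2^-d. *)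
pose P k := [forall i : 'I_d.-1, `|a ord0 i| <= 2 ^+ (k * (d - i))].
have di (i : 'I_d.-1) : (0 < d - i)%N.
  by rewrite subn_gt0 (leq_trans (ltn_ord i)) // leq_pred.
have exP : exists k, P k.
  have /choice[f fP] := fun i : 'I_d.-1 => exp2_ge_norm (a ord0 i).
  exists (\sum_i f i)%N; apply/forallP => i; apply: le_trans (fP i) _.
  rewrite ler_weXn2l ?ler1n // (leq_trans (_ : _ <= \sum_i f i)%N) ?leq_pmulr //.
  by rewrite (bigD1 i) //= leq_addr.
case: (ex_minnP exP) => -[|k] /forallP Pk kmin.
  by apply: le_trans (Pk j) _; rewrite mul0n expr0 lerDl.
have : ~~ P k by apply/negP => /kmin; rewrite ltnn.
case/forallPn => i; rewrite -real_ltNge ?ger0_real ?exprn_ge0 // => ai.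
pose l : C := 2 ^- k.+1.
have l_gt0 : 0 < l by rewrite invr_gt0 exprn_gt0.
have bE m : (rescale 0 l a) ord0 m = l ^+ (d - m) * a ord0 m.
  by rewrite mxE mul0r mul0rn addr0.
have lX n : l ^+ n = 2 ^- (k.+1 * n) by rewrite /l exprVn -exprM.
have [||w bw rw] := r_lt i (rescale 0 l a).
- move=> m; rewrite bE normrM lX normfV normrX normr_nat.
  by rewrite ler_pdivrMl ?exprn_gt0 // mulr1.
(* Failure of [P k] at i gives |a_i| > 2^(k(d-i)), so the rescaled coefficient exceeds 2^-(d-i) >=
   2^-d. *)
- rewrite bE normrM lX normfV normrX normr_nat.
  rewrite ler_pdivlMl ?exprn_gt0 //; apply: le_trans (ltW ai).
  rewrite ler_pdivrMr ?exprn_gt0 // -exprD ler_weXn2l ?ler1n //.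
  by rewrite mulSn addnC leq_add2l leq_subr.
have [|v av wv] := critical_value_rescale d2 _ bw; first by rewrite gt_eqF.
have rM : 2 ^+ (k.+1 * d) <= M / r.
  rewrite ler_pdivlMr // mulrC -ler_pdivlMr ?exprn_gt0 // mulrC -lX.
  apply: le_trans (ltW rw) _; rewrite wv subr0 add0r normrM normrX gtr0_norm //.
  by rewrite ler_wpM2l ?exprn_ge0 ?(ltW l_gt0) // aM.
apply: le_trans (Pk j) _; apply: le_trans (_ : _ <= 2 ^+ (k.+1 * d)) _.
  by rewrite ler_weXn2l ?ler1n // leq_mul2l leq_subr orbT.
by apply: le_trans rM _; rewrite lerDr.
Qed.

Lemma PolyMT_in_compact (X : set C) : compact X -> compact (PolyMT_in d X).
Proof.
move=> cX; have [M M0 XM] := compact_norm_bounded cX.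
have [B aB] := PolyMT_in_bounded M0.
apply: (subclosed_compact
    (B := [set a : PolyMT R d | forall i, [set z : C | `|z - 0| <= B] (a ord0 i)])).
- apply: PolyMT_in_closed => //; by apply: compact_closed cX; exact: norm_hausdorff.
- apply: (@rV_compact C _ (fun=> [set z : C | `|z - 0| <= B])) => i.
  exact: disk_compact.
- by move=> a Xa i /=; rewrite subr0; apply: aB => w /Xa/XM.
Qed.

(** * Inclusion and density *)

Lemma PolyMT_in_sub (X Y : set C) : X `<=` Y -> PolyMT_in d X `<=` PolyMT_in d Y.
Proof. by move=> XY a Xa w /Xa/XY. Qed.

Lemma closure_path (Y : set (PolyMT R d)) (f : C -> PolyMT R d) :
  f t @[t --> (0 : C)^'+] --> f 0 -> (\forall t \near (0 : C)^'+, Y (f t)) ->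
  closure Y (f 0).
Proof.
move=> f0 Yf B /f0 Bf.
have : \forall t \near (0 : C)^'+, (Y `&` B) (f t) by apply: filterI.
by move=> /filter_ex[t Yt]; exists (f t).
Qed.

(** The path [rescale m (1 - t) a] tends to a as t decreases to 0, and its critical values are those
    of a contracted towards m by s = (1 - t)^d. *)
Lemma homothety_dense (X Y : set C) (m : C) :
  (forall s v, 0 < s < 1 -> X v -> Y (m + s * (v - m))) ->
  PolyMT_in d X `<=` closure (PolyMT_in d Y).
Proof.
move=> XY a Xa.
have -> : a = rescale m (1 - 0) a.
  by apply/rowP => i; rewrite mxE subr0 !expr1n mul1r subrr mulr0 mul0rn addr0.
apply: (closure_path (f := fun t => rescale m (1 - t) a)).
  apply: cvg_rV => i; rewrite mxE.
  under eq_fun do rewrite mxE.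
  have t1 : 1 - t @[t --> (0 : C)^'+] --> (1 - 0 : C).
    apply: cvgB; first exact: cvg_cst.
    exact: cvg_at_right_filter cvg_id.
  apply: cvgD; first by apply: cvgMl; exact: cvg_exprn.
  apply: cvgMn; apply: cvgMr; apply: cvgB; first exact: cvg_cst.
  exact: cvg_exprn.
near=> t.
have t0 : 0 < t by near: t; exact: nbhs_right_gt.
have t1 : t < 1 by near: t; exact: nbhs_right_lt.
have s0 : 0 < 1 - t by rewrite subr_gt0.
move=> w /(critical_value_rescale d2 (lt0r_neq0 s0))[v av ->].
apply: XY; last exact: Xa.
rewrite exprn_gt0 // exprn_ilt1 ?(ltW s0) //; first by rewrite -lt0n.
by rewrite ltrBlDr ltrDl.
Unshelve. all: by end_near. Qed.
End Compactness.

(** * Interior points of rectangles and annuli *)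

Section Regions.
Variable R : realType.
Notation C := (Cplx R).

Lemma open_rectangle_interior (z0 u : C) (a b s t : R) : `|u| = 1 ->
  0 < s < a -> 0 < t < b ->
  interior (closed_rectangle z0 u a b) (z0 + u * ((s%:C)%C + 'i%C * (t%:C)%C)).
Proof.
move=> u1 /andP[s0 sa] /andP[t0 tb].
have u_neq0 : u != 0 by rewrite -normr_eq0 u1 oner_eq0.
(* The distance to the nearest side; dividing by the unit u turns displacements into the coordinates
   of the rectangle. *)
pose e := Num.min (Num.min s (a - s)) (Num.min t (b - t)).
have e0 : 0 < e by rewrite !lt_min s0 t0 !subr_gt0 sa tb.
apply/nbhs_normP; exists (e%:C)%C; first by rewrite /= ltcR.
move=> z /=; set v := z0 + _ => vz.
pose y := (z - v) / u.
have ye : `|y| < (e%:C)%C by rewrite normrM normfV u1 invr1 mulr1 distrC.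
have : `|complex.Re y| < e by rewrite -ltcR; apply: le_lt_trans (normc_ge_Re y) ye.
have : `|complex.Im y| < e by rewrite -ltcR; apply: le_lt_trans (normc_ge_Im y) ye.
rewrite !lt_min !ltr_norml => /andP[i1 i2] /andP[r1 r2].
have [e1 e2 e3 e4] : [/\ e <= s, e <= a - s, e <= t & e <= b - t].
  by rewrite !ge_min !lexx !orbT.
exists (s + complex.Re y), (t + complex.Im y); split.
- by apply/andP; split; lra.
- by apply/andP; split; lra.
have -> : z = v + u * y by rewrite /y mulrC divfK // addrC subrK.
rewrite [y in LHS]complexE !rmorphD /v.
by ring.
Qed.

Lemma open_annulus_interior (c : C) (r1 r2 : R) z :
  (r1%:C)%C < `|z - c| < (r2%:C)%C -> interior (closed_annulus c r1 r2) z.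
Proof.
move=> /andP[z1 z2].
have : \forall y \near z,
    `|z - y| < `|z - c| - (r1%:C)%C /\ `|z - y| < (r2%:C)%C - `|z - c|.
  apply: filterI; apply/nbhs_normP.
    by exists (`|z - c| - (r1%:C)%C); rewrite //= subr_gt0.
  by exists ((r2%:C)%C - `|z - c|); rewrite //= subr_gt0.
apply: filterS => y [y1 y2]; apply/andP; split.
  rewrite -(lerD2l `|z - y|); apply: le_trans _ (ler_distD y z c).
  by rewrite -lerBrDr ltW.
apply: le_trans (ler_distD z y c) _.
by rewrite -lerBrDr distrC ltW.
Qed.
End Regions.

(** * Density for the annulus *)

Section Annulus.
Variables (R : realType) (d : nat) (c : Cplx R) (r1 r2 : R).
Hypotheses (d2 : (2 <= d)%N) (r1_gt0 : 0 < r1) (r12 : r1 < r2).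
Notation C := (Cplx R).

Let eta : C := (((r2 - r1) / 2)%:C)%C.
Let rho : C := (((r1 + r2) / 2)%:C)%C.

Let eta_gt0 : 0 < eta.
Proof. by rewrite ltcR divr_gt0 // subr_gt0. Qed.

Let rho_r1 : rho = (r1%:C)%C + eta.
Proof. by rewrite -rmorphD; congr (_%:C)%C; field. Qed.

Let rho_r2 : rho = (r2%:C)%C - eta.
Proof. by rewrite -rmorphB; congr (_%:C)%C; field. Qed.

(** The radial displacement from v to the middle circle: v + [inward v] is at distance [rho] from c
    in the direction of v. *)
Let inward (v : C) := (rho - `|v - c|) * ((v - c) / `|v - c|).

(** The distance to c becomes (1 - t) |v - c| + t rho, a convex combination. The margin t eta from
    both boundary circles is linear in t, so it absorbs an O(t^2) error. *)
Lemma inward_norm (v t : C) : closed_annulus c r1 r2 v -> 0 < t < 1 ->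
  (r1%:C)%C + t * eta <= `|v + t * inward v - c| <= (r2%:C)%C - t * eta.
Proof.
move=> /andP[v1 v2] /andP[t0 t1].
have v_gt0 : 0 < `|v - c| by apply: lt_le_trans v1; rewrite ltcR.
have -> : v + t * inward v - c =
    ((1 - t) * `|v - c| + t * rho) * ((v - c) / `|v - c|).
  have {1}-> : v = c + `|v - c| * ((v - c) / `|v - c|).
    by rewrite mulrC divfK ?gt_eqF // addrC subrK.
  by rewrite /inward; ring.
have s0 : 0 <= 1 - t by rewrite subr_ge0 ltW.
have rho_ge0 : 0 <= rho.
  by rewrite lecR divr_ge0 // addr_ge0 // ltW // (lt_trans r1_gt0 r12).
rewrite normrM normf_div normr_id divff ?gt_eqF // mulr1 ger0_norm; last first.
  by rewrite addr_ge0 ?mulr_ge0 // ltW.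
apply/andP; split.
  have -> : (r1%:C)%C + t * eta = (1 - t) * (r1%:C)%C + t * rho.
    by rewrite rho_r1; ring.
  by rewrite lerD2r ler_wpM2l.
have -> : (r2%:C)%C - t * eta = (1 - t) * (r2%:C)%C + t * rho.
  by rewrite rho_r2; ring.
by rewrite lerD2r ler_wpM2l.
Qed.

Lemma annulus_dense :
  PolyMT_in d (closed_annulus c r1 r2) `<=`
  closure (PolyMT_in d (interior (closed_annulus c r1 r2))).
Proof.
move=> a Ka; set p := cpoly a.
have p_monic : p \is monic by exact: cpoly_monic.
have p_size : (1 < size p)%N by rewrite size_cpoly // ltnS ltnW.
have [s p's] := closed_field_poly_normal (p^`())%R.
(* A polynomial F agreeing with [inward] at the finitely many critical values makes the perturbation
   push each of them inwards. *)
have [F FP] := lagrange_interpolation [seq p.[z] | z <- s] inward.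
have [M M0 [t0 /andP[t0_gt0 t0_le1] critP]] :=
  perturbed_crit_value F p_monic p_size.
set h := (F \Po p) %% (p^`())%R in critP.
have sh : (size h <= d.-1)%N.
  have := size_perturbation F p_size.
  by rewrite -/h size_cpoly //= => hd; rewrite -ltnS prednK // ltnW.
have bE t : p + t *: h = cpoly (a + t *: poly_rV h).
  rewrite cpolyD; first by rewrite linearZ.
  by apply: leq_trans (size_scale_leq _ _) sh.
have -> : a = a + 0 *: poly_rV h by rewrite scale0r addr0.
apply: (closure_path (f := fun t => a + t *: poly_rV h)).
  apply: cvgD; first exact: cvg_cst.
  apply: cvgZr_tmp; exact: cvg_at_right_filter cvg_id.
near=> t.
have t_gt0 : 0 < t by near: t; exact: nbhs_right_gt.
have tt0 : t < t0 by near: t; exact: nbhs_right_lt.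
(* This makes the error M t^2 smaller than the margin t eta; the added 1 covers M = 0. *)
have t_eta : t < eta / (M + 1).
  by near: t; apply: nbhs_right_lt; rewrite divr_gt0 // ltr_wpDl.
have t1 : t < 1 by apply: lt_le_trans tt0 t0_le1.
move=> w [z []]; rewrite -bE => qz <-.
have [|x p'x xz] := critP t z _ qz; first by rewrite t_gt0.
have xs : x \in s.
  move: p'x; rewrite p's rootZ ?root_prod_XsubC // lead_coef_eq0.
  exact: deriv_monic_eq0.
have Kx : closed_annulus c r1 r2 p.[x] by apply: Ka; exists x.
have /andP[x1 x2] := inward_norm Kx (introT andP (conj t_gt0 t1)).
have Mt : M * t ^+ 2 < t * eta.
  rewrite expr2 mulrA mulrC ltr_pM2l //.
  apply: le_lt_trans (_ : _ <= (M + 1) * t) _; first by rewrite ler_pM2r // lerDl.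
  by rewrite mulrC -ltr_pdivlMr // ltr_wpDl.
rewrite FP ?map_f // in xz.
set y := p.[x] + _ in xz x1 x2; set z' := (_).[z] in xz *.
have yz := le_lt_trans xz Mt.
apply: open_annulus_interior; apply/andP; split.
  rewrite -(ltrD2r (t * eta)); apply: le_lt_trans x1 _.
  apply: le_lt_trans (ler_distD z' y c) _.
  by rewrite addrC ltrD2l distrC.
rewrite -[ltRHS](subrK (t * eta)); apply: le_lt_trans (ler_distD y z' c) _.
by rewrite addrC; apply: ler_ltD.
Unshelve. all: by end_near. Qed.
End Annulus.

Theorem theoremF (R : realType) (d : nat) (hd : (2 <= d)%N) :
  [/\ (forall (z0 u : Cplx R) (a b : R), `|u| = 1 -> 0 < a -> 0 < b ->
         is_compactification (PolyMT_in d (closed_rectangle z0 u a b))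
                             (PolyMT_in d (interior (closed_rectangle z0 u a b)))),
      (forall (c : Cplx R) (r1 r2 : R), 0 < r1 -> r1 < r2 ->
         is_compactification (PolyMT_in d (closed_annulus c r1 r2))
                             (PolyMT_in d (interior (closed_annulus c r1 r2))))
    & (forall p q : Cplx R, p != q ->
         is_compactification (PolyMT_in d (closed_segment p q))
                             (PolyMT_in d (open_segment p q)))].
Proof.
split.
- move=> z0 u a b u1 a0 b0; split.
  + by apply: PolyMT_in_compact => //; exact: closed_rectangle_compact.
  + by apply: PolyMT_in_sub; exact: interior_subset.
  (* The center of the rectangle: homotheties of ratio below 1 about it send the closed rectangle
     into its interior. *)
  pose m := z0 + u * (((a / 2)%:C)%C + 'i%C * ((b / 2)%:C)%C).
  apply: (homothety_dense hd (m := m)).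
  move=> l v /andP[l0 l1] [s [t [/andP[s0 sa] /andP[t0 tb] ->]]].
  (* A positive element of [C] is real, so the homothety acts separately on the two real
     coordinates. *)
  have /complex_realP[k lk] := gtr0_real l0.
  rewrite {}lk !ltcR in l0 l1 *.
  set w := (X in interior _ X).
  have -> : w = z0 + u * (((a / 2 + k * (s - a / 2))%:C)%C +
                        'i%C * ((b / 2 + k * (t - b / 2))%:C)%C).
    by rewrite /w /m !(rmorphD, rmorphN, rmorphM); ring.
  by apply: open_rectangle_interior => //; apply/andP; split; nra.
- move=> c r1 r2 r1_gt0 r12; split.
  + by apply: PolyMT_in_compact => //; exact: closed_annulus_compact.
  + by apply: PolyMT_in_sub; exact: interior_subset.
  exact: annulus_dense.
move=> p q _; split.
+ by apply: PolyMT_in_compact => //; exact: closed_segment_compact.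
+ apply: PolyMT_in_sub => z [t [/andP[t0 t1] ->]].
  by exists t; split => //; rewrite !ltW.
(* Contraction towards the midpoint moves the parameter t to 1/2 + k (t - 1/2), strictly between 0
   and 1. *)
apply: (homothety_dense hd (m := p + ((1 / 2)%:C)%C * (q - p))).
move=> l v /andP[l0 l1] [t [/andP[t0 t1] ->]].
have /complex_realP[k lk] := gtr0_real l0.
rewrite {}lk !ltcR in l0 l1 *.
exists (1 / 2 + k * (t - 1 / 2)); split.
  by apply/andP; split; nra.
by rewrite !(rmorphD, rmorphN, rmorphM); ring.
Qed.
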